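(* Let $X$ be a nonempty closed convex subset of a real Hilbert space $H$ and let $F:X\to H$ be strongly pseudomonotone on $X$ with modulus $\mu>0$ and Lipschitz continuous on $X$ with constant $L>0$. Let $x_1\in X$ and let $\{x_n\}$ be generated by $$x_{n+1}=P_X\big(x_n-\gamma_nF(x_n)\big),\quad n=1,2,\dots,$$ where $$\frac{L^2}{2\mu}\le\gamma_n\le\sigma<1\quad\text{for all } n=1,2,\dots$$ for some positive constant $\sigma$. Assume further that $F$ is monotone on $X$ and that the solution set of the variational inequality problem for $(F,X)$ is $X^*=\{x^*\}$ and is weakly sharp with modulus $\alpha>0$. Then $\{x_n\}$ converges to $x^*$ in at most $\ell$ iterates, i.e. there is a positive integer $\ell$ with $$\ell\le\frac{\|x_1-x^*\|^2(2\mu+L^3)^2}{(1-\sigma^2)\alpha^2L^4}+1$$ such that $x_n=x^*$ for all $n\ge\ell+1$.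
   Context: $H$ is a real Hilbert space with inner product $\langle\cdot,\cdot\rangle$, norm $\|\cdot\|$ and closed unit ball $\mathbb{B}$. The solution set is $X^*=\{x^*\in X : \langle F(x^* ),x-x^*\rangle\ge 0 \text{ for all } x\in X\}$. $F$ is monotone on $X$ if $\langle F(x)-F(y),x-y\rangle\ge 0$ for all $x,y\in X$. $F$ is strongly pseudomonotone on $X$ with modulus $\mu>0$ if for all $x,y\in X$, $\langle F(x),y-x\rangle\ge 0$ implies $\langle F(y),y-x\rangle\ge\mu\|y-x\|^2$ (then the solution set has at most one element). $P_C(x)$ is the unique point of a nonempty closed convex set $C$ nearest to $x$. The polar of $C\subseteq H$ is $C^\circ=\{u\in H:\langle u,x\rangle\le 0\ \text{for all } x\in C\}$. For a closed convex set $C$ and $x\in C$, the tangent cone is $T_C(x)=\mathrm{cl}\big(\bigcup_{\lambda>0}\frac{C-x}{\lambda}\big)$ and the normal cone is $N_C(x)=[T_C(x)]^\circ$. $X^*$ is called weakly sharp if $-F(x^* )\in\mathrm{int}\Big(\bigcap_{x\in X^*}\big[T_X(x)\cap N_{X^*}(x)\big]^\circ\Big)$ for all $x^*\in X^*$. $X^*$ is weakly sharp with modulus $\alpha>0$ if it is weakly sharp and $\alpha\mathbb{B}\subset F(x^* )+[T_X(x^* )\cap N_{X^*}(x^* )]^\circ$ for every $x^*\in X^*$; equivalently (for this last inclusion) $\langle F(x^* ),v\rangle\ge\alpha\|v\|$ for all $x^*\in X^*$ and all $v\in T_X(x^* )\cap N_{X^*}(x^* )$. *)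

(* Defs.v *)
From HB Require Import structures.
From mathcomp Require Import all_boot all_order all_algebra sesquilinear ring lra.
From mathcomp Require Import all_classical all_reals all_analysis.

Set Implicit Arguments.
Unset Strict Implicit.
Unset Printing Implicit Defensive.

Import Order.TTheory GRing.Theory Num.Theory.
Import numFieldNormedType.Exports.

Local Open Scope classical_set_scope.
Local Open Scope ring_scope.

(* A real Hilbert space is a complete normed module H whose norm comes from a
   symmetric positive definite bilinear form on H. *)
Definition induces_norm (R : realType) (H : normedModType R)
    (dot : {dot H for idfun}) :=
  forall u : H, dot u u = `|u| ^+ 2.

Section Definitions.
Variables (R : realType) (H : completeNormedModType R).
Variable dot : {dot H for idfun}.

Definition nearest_points (C : set H) (x : H) : set H :=
  [set p | C p /\ forall q, C q -> `|x - p| <= `|x - q|].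

(* Meaningful only when C has a unique point nearest to x; see
   [nearest_pointsE]. *)
Definition metric_proj (C : set H) (x : H) : H := get (nearest_points C x).

Definition polar (C : set H) : set H :=
  [set u | forall x, C x -> dot u x <= 0].

Definition tangent_cone (C : set H) (x : H) : set H :=
  closure (\bigcup_(lambda in [set l : R | 0 < l])
             [set lambda^-1 *: (c - x) | c in C]).

Definition normal_cone (C : set H) (x : H) : set H :=
  polar (tangent_cone C x).

(* In the definitions below only the values of F on X matter. *)
Definition solution_set (X : set H) (F : H -> H) : set H :=
  [set s | X s /\ forall x, X x -> 0 <= dot (F s) (x - s)].

Definition monotone_on (X : set H) (F : H -> H) :=
  forall x y, X x -> X y -> 0 <= dot (F x - F y) (x - y).

Definition strongly_pseudomonotone_on (mu : R) (X : set H) (F : H -> H) :=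
  forall x y, X x -> X y ->
    0 <= dot (F x) (y - x) -> mu * `|y - x| ^+ 2 <= dot (F y) (y - x).

(* S stands for the solution set of the variational inequality for (F, X). *)
Definition weakly_sharp (X : set H) (F : H -> H) (S : set H) :=
  forall s, S s ->
    interior (\bigcap_(x in S) polar (tangent_cone X x `&` normal_cone S x))
      (- F s).

Definition weakly_sharp_with_modulus (alpha : R) (X : set H) (F : H -> H)
    (S : set H) :=
  weakly_sharp X F S /\
  forall s, S s ->
    [set alpha *: b | b in closed_ball (0 : H) 1] `<=`
    [set F s + u | u in polar (tangent_cone X s `&` normal_cone S s)].

End Definitions.

Section Projection.
Variables (R : realType) (H : completeNormedModType R).
Variable dot : {dot H for idfun}.
Hypothesis dotE : induces_norm dot.

Let parallelogram (u v : H) :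
  `|u - v| ^+ 2 + `|u + v| ^+ 2 = 2 * `|u| ^+ 2 + 2 * `|v| ^+ 2.
Proof.
rewrite -!dotE !linearBl !linearDl !linearBr !linearDr /=; ring.
Qed.

Let midpoint (C : set H) (u v : H) :
  convex_set C -> C u -> C v -> C (2^-1 *: (u + v)).
Proof.
move=> cC Cu Cv.
have h0 : 0 <= (2^-1 : R) by lra.
have h1 : (2^-1 : R) <= 1 by lra.
have := cC u v (Itv01 h0 h1) (mem_set Cu) (mem_set Cv).
rewrite inE; congr C.
rewrite scalerDr /conv/=; congr (_ *: _ + _ *: _).
by change (1 - 2^-1 = 2^-1 :> R); lra.
Qed.

Let near_bound (C : set H) (x u v : H) (m : R) :
  convex_set C -> C u -> C v ->
  (forall q, C q -> m <= `|x - q| ^+ 2) ->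
  `|u - v| ^+ 2 <= 2 * (`|x - u| ^+ 2 - m) + 2 * (`|x - v| ^+ 2 - m).
Proof.
move=> cC Cu Cv mq.
have := parallelogram (x - v) (x - u).
have -> : x - v - (x - u) = u - v by rewrite opprB addrC addrA subrK.
have -> : x - v + (x - u) = 2 *: (x - 2^-1 *: (u + v)).
  rewrite scalerBr scalerA divff// scale1r scaler_nat mulr2n.
  by rewrite addrACA -opprD [v + u]addrC.
rewrite normrZ exprMn ger0_norm//.
by have := mq _ (midpoint cC Cu Cv); nra.
Qed.

Let nearest_exists (C : set H) (x : H) :
  C !=set0 -> closed C -> convex_set C -> nearest_points C x !=set0.
Proof.
move=> [c0 Cc0] clC cC.
pose D := [set `|x - q| ^+ 2 | q in C].
have D0 : has_inf D.
  by split; [exists (`|x - c0| ^+ 2), c0|exists 0 => _ [q _ <-]; exact: sqr_ge0].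
pose m := inf D.
have mq q : C q -> m <= `|x - q| ^+ 2.
  by move=> Cq; apply: ge_inf; [exact: D0.2|exists q].
have /choice[q qP] : forall n : nat, exists q,
    C q /\ `|x - q| ^+ 2 < m + n.+1%:R^-1.
  move=> n; have n0 : 0 < n.+1%:R^-1 :> R by rewrite invr_gt0.
  by have [_ [q Cq <-] ltq] := inf_adherent n0 D0; exists q.
have qc : cauchy (q n @[n --> \oo]).
  apply: cauchy_exP => e e0.
  have e4 : 0 < e ^+ 2 / 4 by rewrite divr_gt0// exprn_gt0.
  have [N _ NP] := near_infty_natSinv_lt (PosNum e4).
  exists (q N); exists N => // n /= Nn.
  rewrite -ball_normE /ball_/= -(ltr_pXn2r (n := 2)) ?nnegrE// ?ltW//.
  have [[CN qN] [Cn qn]] := (qP N, qP n).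
  have := near_bound cC CN Cn mq.
  have /= iN : N.+1%:R^-1 < e ^+ 2 / 4 := NP _ (leqnn N).
  have /= i_n : n.+1%:R^-1 < e ^+ 2 / 4 := NP _ Nn.
  set a := `|q N - q n| ^+ 2; set b := `|x - q N| ^+ 2 in qN *.
  set c := `|x - q n| ^+ 2 in qn *; set d := e ^+ 2 in iN i_n *.
  have bE : b - m < d / 4 by rewrite ltrBlDl (lt_trans qN)// ltrD2l.
  have cE : c - m < d / 4 by rewrite ltrBlDl (lt_trans qn)// ltrD2l.
  move=> /le_lt_trans; apply.
  have -> : d = 2 * (d / 4) + 2 * (d / 4) by field.
  by rewrite ltrD// ltr_pM2l.
have [p qp] : exists p : H, q n @[n --> \oo] --> p.
  by apply/cvg_ex; apply: cauchy_cvg qc.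
exists p; split.
  by apply: (closed_cvg _ clC _ _ qp); apply: nearW => n; exact: (qP n).1.
suff xp : `|x - p| ^+ 2 <= m.
  by move=> c Cc; rewrite -(ler_pXn2r (n := 2)) ?nnegrE// (le_trans xp)// mq.
apply/ler_addgt0Pr => e e0.
have xq : `|x - q n| ^+ 2 @[n --> \oo] --> `|x - p| ^+ 2.
  have xq : `|x - q n| @[n --> \oo] --> `|x - p|.
    by apply: cvg_norm; apply: cvgB => //; exact: cvg_cst.
  exact: cvgM.
apply: (cvgr_to_le xq); have := near_infty_natSinv_lt (PosNum e0).
by apply: filterS => n /= ne; rewrite ltW// (lt_trans (qP n).2)// ltrD2l.
Qed.

Let nearest_unique (C : set H) (x p p' : H) :
  convex_set C -> nearest_points C x p -> nearest_points C x p' -> p = p'.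
Proof.
move=> cC [Cp xp] [Cp' xp'].
have mq q : C q -> `|x - p| ^+ 2 <= `|x - q| ^+ 2.
  by move=> Cq; rewrite ler_pXn2r ?nnegrE// xp.
have := near_bound cC Cp Cp' mq.
rewrite (@le_anti _ _ `|x - p'| `|x - p|) ?xp' ?xp// subrr mulr0 addr0.
have := sqr_ge0 `|p - p'| => ge0 le0.
have : `|p - p'| ^+ 2 == 0 by rewrite eq_le le0.
by rewrite expf_eq0 /= normr_eq0 subr_eq0 => /eqP.
Qed.

Lemma nearest_pointsE (C : set H) (x : H) :
  C !=set0 -> closed C -> convex_set C ->
  nearest_points C x = [set metric_proj C x].
Proof.
move=> C0 clC cC; have Pp := getPex (nearest_exists x C0 clC cC).
by apply/seteqP; split=> [p xp|_ ->//]; exact: nearest_unique xp Pp.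
Qed.

End Projection.

(* Main.v *)
Require Import Defs.
From HB Require Import structures.
From mathcomp Require Import all_boot all_order all_algebra sesquilinear.
From mathcomp Require Import ring lra.
From mathcomp Require Import all_classical all_reals all_analysis.

(** Write [s] for the solution and [a], [b] for two consecutive iterates, so
that [b] is the projection of [a - gamma *: F a]. The projection makes an
obtuse angle at [b] with [s], which says that [gamma * dot (F a) (b - s) <=
dot (a - b) (b - s)]. In the left-hand side [F a] can be exchanged for [F b]
at the cost of [gamma * L * |a - b| * |b - s|], and the two hypotheses that
bound [dot (F b) (b - s)] from below then play different roles.

Strong pseudomonotonicity bounds it by [mu * |b - s| ^+ 2]. Twice the exchange
cost is at most [gamma ^+ 2 * |a - b| ^+ 2 + L ^+ 2 * |b - s| ^+ 2]; because
[L ^+ 2 <= 2 * mu * gamma], the last term is absorbed, and the squared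
distance to [s] drops by at least [(1 - gamma ^+ 2) * |a - b| ^+ 2]
([projected_step_descent]).

Since the solution set is a singleton, its normal cone is the whole space and
weak sharpness yields the growth [alpha * |y - s| <= dot (F s) (y - s)] on [X]
([weakly_sharp_singleton_growth]); monotonicity transfers it from [F s] to
[F b]. This bound is of first order in [|b - s|], so that [|b - s|] cancels and
a step that does not land on [s] is long:
[gamma * alpha <= (1 + gamma * L) * |a - b|] ([projected_step_length]).

Hence each step that misses [s] lowers the squared distance by a fixed
positive amount, and there can be only finitely many
([fixed_drop_vanishing]). *)

Set Implicit Arguments.
Unset Strict Implicit.
Unset Printing Implicit Defensive.

Import Order.TTheory GRing.Theory Num.Theory.
Import numFieldNormedType.Exports.

Local Open Scope classical_set_scope.
Local Open Scope ring_scope.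

(** * Geometry of the inner product: projections and weak sharpness *)

Section InnerProduct.
Variables (R : realType) (H : completeNormedModType R).
Variable dot : {dot H for idfun}.
Hypothesis dotE : induces_norm dot.

Lemma dot_sym (u v : H) : dot u v = dot v u.
Proof. by rewrite hermC/= expr0 mul1r. Qed.

Lemma sqr_normD (u v : H) :
  `|u + v| ^+ 2 = `|u| ^+ 2 + 2 * dot u v + `|v| ^+ 2.
Proof.
by rewrite -!dotE linearDl !linearDr/= (dot_sym v u); ring.
Qed.

(** The triangle inequality of the norm, squared and expanded. *)
Lemma dot_le_norm (u v : H) : dot u v <= `|u| * `|v|.
Proof.
have : `|u + v| ^+ 2 <= (`|u| + `|v|) ^+ 2.
  by rewrite ler_pXn2r ?nnegrE ?addr_ge0// ler_normD.
rewrite sqr_normD; nra.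
Qed.

(** To first order, moving from [p] a little towards [y] changes the squared
distance to [z] by a positive multiple of [- dot (z - p) (y - p)], which
therefore cannot be negative. *)
Lemma nearest_point_obtuse (C : set H) (z p y : H) :
  convex_set C -> nearest_points C z p -> C y -> dot (z - p) (y - p) <= 0.
Proof.
move=> cC [Cp zp] Cy; rewrite leNgt; apply/negP.
set c := dot (z - p) (y - p) => c0; pose e := `|y - p| ^+ 2.
have e0 : 0 <= e by rewrite sqr_ge0.
have ce0 : 0 < c + e by rewrite ltr_pwDl.
(* With [t = c / (c + e)], [2 * c <= t * e] fails and [t <= 1]. *)
pose t := c / (c + e).
have t0 : 0 < t by rewrite divr_gt0.
have t1 : t <= 1 by rewrite ler_pdivrMr// mul1r lerDl.
have Ct : C (p + t *: (y - p)).
  have := cC y p (Itv01 (ltW t0) t1) (mem_set Cy) (mem_set Cp).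
  rewrite inE; congr C.
  rewrite /conv/= [unstable.onem t]/(1 - t) scalerBr scalerBl scale1r.
  by rewrite addrCA.
have : `|z - p| ^+ 2 <= `|z - (p + t *: (y - p))| ^+ 2.
  by rewrite ler_pXn2r ?nnegrE// zp.
rewrite opprD addrA (sqr_normD (z - p)) linearNr linearZr_LR/= -/c.
rewrite normrN normrZ (gtr0_norm t0) exprMn -/e => le.
have tE : t * (c + e) = c by rewrite /t divfK// gt_eqF.
by nra.
Qed.

(** The tangent cone of [[set s]] at [s] is zero, so its normal cone does not
restrict the tangent directions of [X]; testing the inclusion with the unit
vector along [y - s] gives the growth. *)
Lemma weakly_sharp_singleton_growth (X : set H) (F : H -> H) (alpha : R)
    (s : H) :
  weakly_sharp_with_modulus dot alpha X F [set s] ->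
  forall y, X y -> alpha * `|y - s| <= dot (F s) (y - s).
Proof.
move=> [_ sharp] y Xy.
have [->|ys] := eqVneq y s; first by rewrite subrr normr0 mulr0 linear0r.
have ys0 : `|y - s| != 0 by rewrite normr_eq0 subr_eq0.
have Tys : (tangent_cone X s `&` normal_cone dot [set s] s) (y - s).
  split.
    apply: subset_closure; exists 1 => /=; first exact: ltr01.
    by exists y => //; rewrite invr1 scale1r.
  have T0 : tangent_cone [set s] s `<=` [set 0].
    have /closure_id -> : closed [set (0 : H)].
      apply: accessible_closed_set1.
      exact: hausdorff_accessible (@norm_hausdorff _ _).
    by apply: closureS => _ [l _ [_ -> <-]]; rewrite subrr scaler0.
  by move=> v /T0 ->; rewrite linear0r.
have [] := sharp s erefl (alpha *: (`|y - s|^-1 *: (y - s))).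
  exists (`|y - s|^-1 *: (y - s)) => //.
  rewrite closed_ballE// /closed_ball_/= sub0r normrN normrZ normfV normr_id.
  by rewrite mulVf.
move=> u uP /(congr1 (dot ^~ (y - s))).
rewrite linearDl !linearZl_LR/= dotE expr2 mulKf// => <-.
by rewrite gerDl uP.
Qed.

End InnerProduct.

(** * One projected step from [a] to [b] *)

Section ProjectedStep.
Variables (R : realType) (H : completeNormedModType R).
Variable dot : {dot H for idfun}.
Hypothesis dotE : induces_norm dot.
Variables (F : H -> H) (L gamma : R) (a b s : H).
Hypothesis gamma_gt0 : 0 < gamma.
Hypothesis obtuse : dot (a - gamma *: F a - b) (s - b) <= 0.
Hypothesis lip : `|F a - F b| <= L * `|a - b|.

(** The obtuse angle at [b], with the value of [F] at the old iterate replaced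
by the value at the new one. *)
Lemma projected_step_bound :
  gamma * (dot (F b) (b - s) - L * `|a - b| * `|b - s|) <=
  dot (a - b) (b - s).
Proof.
have ab : gamma * dot (F a) (b - s) <= dot (a - b) (b - s).
  move: obtuse; rewrite -(opprB b s) linearNr !linearBl linearZl_LR/=; lra.
apply: le_trans ab; rewrite ler_pM2l// lerBlDr -lerBlDl -linearBl/=.
apply: le_trans (dot_le_norm dotE _ _) _.
by rewrite distrC ler_wpM2r.
Qed.

(** The quadratic lower bound on [dot (F b) (b - s)] pays for the part of the
exchange cost that is quadratic in [|b - s|]; the rest is a fraction
[gamma ^+ 2] of the step length squared, which the Pythagorean expansion of
[|a - s| ^+ 2] provides. *)
Lemma projected_step_descent (mu : R) :
  mu * `|b - s| ^+ 2 <= dot (F b) (b - s) -> L ^+ 2 <= 2 * mu * gamma ->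
  `|b - s| ^+ 2 + (1 - gamma ^+ 2) * `|a - b| ^+ 2 <= `|a - s| ^+ 2.
Proof.
move=> Fb Lmu.
have -> : a - s = (a - b) + (b - s) by rewrite addrA subrK.
rewrite (sqr_normD dotE (a - b)).
have := projected_step_bound.
have := ler_wpM2l (ltW gamma_gt0) Fb.
have := ler_wpM2r (sqr_ge0 `|b - s|) Lmu.
(* Young's inequality for the exchange cost. *)
have := sqr_ge0 (gamma * `|a - b| - L * `|b - s|).
lra.
Qed.

(** Every term of the obtuse-angle inequality is here bounded by a multiple of
[|b - s|], which cancels when [b] differs from [s]. *)
Lemma projected_step_length (alpha : R) :
  alpha * `|b - s| <= dot (F b) (b - s) -> b != s ->
  gamma * alpha <= (1 + gamma * L) * `|a - b|.
Proof.
move=> Fb bs; have bs0 : 0 < `|b - s| by rewrite normr_gt0 subr_eq0.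
rewrite -(ler_pM2r bs0).
have := projected_step_bound; have := dot_le_norm dotE (a - b) (b - s).
have := ler_wpM2l (ltW gamma_gt0) Fb.
nra.
Qed.

End ProjectedStep.

(** * Counting the steps *)

(** After [n] steps with [d n] still nonzero, [n * c] has been lost out of
[d 0], so [n < d 0 / c]. *)
Lemma fixed_drop_vanishing (R : realType) (d : nat -> R) (c : R) :
  0 < c -> (forall n, 0 <= d n) -> (forall n, d n.+1 <= d n) ->
  (forall n, d n.+1 != 0 -> d n.+1 + c <= d n) ->
  exists l : nat, [/\ (1 <= l)%N, l%:R <= d 0%N / c + 1 &
    forall n, (l <= n)%N -> d n = 0].
Proof.
move=> c0 d0 dS dc.
have dn : nonincreasing_seq d by apply/nonincreasing_seqP.
have drop n : d n != 0 -> d n + n%:R * c <= d 0%N.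
  elim: n => [|n IHn] dn0; first by rewrite mul0r addr0.
  have dnc := dc _ dn0.
  apply: le_trans (IHn _).
    by rewrite -natr1; lra.
  by rewrite gt_eqF// (lt_le_trans _ dnc)// ltr_wpDl.
have q0 : 0 <= d 0%N / c by rewrite divr_ge0// ltW.
have /andP[lq ql] := truncn_itv q0.
exists (Num.truncn (d 0%N / c)).+1; split=> //.
  by rewrite -natr1 lerD2r.
move=> n ln; apply/eqP; rewrite eq_le d0 andbT (le_trans (dn _ _ ln))//.
rewrite leNgt; apply/negP => dl; have := drop _ (lt0r_neq0 dl).
move: ql; rewrite ltr_pdivrMr//; lra.
Qed.

(** [gamma / (1 + gamma * L)] increases with [gamma]; at the smallest step size
[L ^+ 2 / (2 * mu)] it is [L ^+ 2 / (2 * mu + L ^+ 3)]. *)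
Lemma step_length_uniform (R : realType) (mu L gamma alpha r : R) :
  0 < mu -> 0 < L -> 0 < alpha -> L ^+ 2 / (2 * mu) <= gamma ->
  gamma * alpha <= (1 + gamma * L) * r ->
  alpha * L ^+ 2 / (2 * mu + L ^+ 3) <= r.
Proof.
move=> mu0 L0 alpha0; have mu2 : 0 < 2 * mu by rewrite mulr_gt0.
rewrite ler_pdivrMr// => Lg gr.
have g0 : 0 < gamma.
  by rewrite -(pmulr_lgt0 _ mu2) (lt_le_trans _ Lg)// exprn_gt0.
have K0 : 0 < 2 * mu + L ^+ 3 by rewrite addr_gt0// exprn_gt0.
have h : 0 < 1 + gamma * L by rewrite addr_gt0// mulr_gt0.
rewrite ler_pdivrMr// -(ler_pM2l h).
have := ler_wpM2r (ltW K0) gr; have := ler_wpM2r (ltW alpha0) Lg.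
lra.
Qed.

Theorem theorem4p9 (R : realType) (H : completeNormedModType R)
    (dot : {dot H for idfun}) (hdot : induces_norm dot)
    (X : set H) (X_nonempty : X !=set0) (X_closed : closed X)
    (X_convex : convex_set X)
    (F : H -> H) (mu L : R) (mu_gt0 : 0 < mu) (L_gt0 : 0 < L)
    (F_spm : strongly_pseudomonotone_on dot mu X F)
    (F_lip : L.-lipschitz_X F)
    (x : nat -> H) (gamma : nat -> R) (sigma : R)
    (x1X : X (x 1%N))
    (xS : forall n : nat, (1 <= n)%N ->
      x n.+1 = metric_proj X (x n - gamma n *: F (x n)))
    (sigma_gt0 : 0 < sigma) (sigma_lt1 : sigma < 1)
    (gamma_bounds : forall n : nat, (1 <= n)%N ->
      L ^+ 2 / (2 * mu) <= gamma n /\ gamma n <= sigma)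
    (F_mono : monotone_on dot X F)
    (xstar : H) (sol : solution_set dot X F = [set xstar])
    (alpha : R) (alpha_gt0 : 0 < alpha)
    (sharp : weakly_sharp_with_modulus dot alpha X F (solution_set dot X F)) :
  exists l : nat,
    [/\ (1 <= l)%N,
        l%:R <= `|x 1%N - xstar| ^+ 2 * (2 * mu + L ^+ 3) ^+ 2
                / ((1 - sigma ^+ 2) * alpha ^+ 2 * L ^+ 4) + 1
      & forall n : nat, (l + 1 <= n)%N -> x n = xstar].
Proof.
have [Xs s_sol] : solution_set dot X F xstar by rewrite sol.
have growth := @weakly_sharp_singleton_growth _ _ _ hdot X F alpha xstar.
rewrite sol in sharp; move/(_ sharp) in growth.
have nearest n : (1 <= n)%N ->
    nearest_points X (x n - gamma n *: F (x n)) (x n.+1).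
  by move=> n1; rewrite (nearest_pointsE hdot)// xS.
have Xx n : X (x n.+1) by case: n => // n; have [] := nearest n.+1 isT.
have obtuse n : dot (x n.+1 - gamma n.+1 *: F (x n.+1) - x n.+2)
    (xstar - x n.+2) <= 0.
  by apply: (nearest_point_obtuse hdot X_convex) => //; exact: nearest.
have lip n : `|F (x n.+1) - F (x n.+2)| <= L * `|x n.+1 - x n.+2|.
  by have := F_lip (x n.+1, x n.+2); apply; split; exact: Xx.
have Lg n : L ^+ 2 / (2 * mu) <= gamma n.+1 by have [] := gamma_bounds n.+1 isT.
have gs n : gamma n.+1 <= sigma by have [] := gamma_bounds n.+1 isT.
have g0 n : 0 < gamma n.+1.
  by apply: lt_le_trans (Lg n); rewrite divr_gt0 ?mulr_gt0 ?exprn_gt0.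
(* The iterates are numbered from 1 and [d] from 0. *)
pose d n := `|x n.+1 - xstar| ^+ 2.
have descent n :
    d n.+1 + (1 - sigma ^+ 2) * `|x n.+1 - x n.+2| ^+ 2 <= d n.
  have sg : gamma n.+1 ^+ 2 <= sigma ^+ 2.
    by rewrite ler_pXn2r ?nnegrE// ltW.
  have := projected_step_descent hdot (g0 n) (obtuse n) (lip n).
  move=> /(_ _ (F_spm _ _ Xs (Xx _) (s_sol _ (Xx _)))).
  have Lmu : L ^+ 2 <= 2 * mu * gamma n.+1.
    by rewrite mulrC -ler_pdivrMr ?mulr_gt0.
  move=> /(_ Lmu); apply: le_trans.
  by rewrite lerD2l ler_wpM2r ?sqr_ge0// lerB.
have s2 : 0 < 1 - sigma ^+ 2 by rewrite subr_gt0 expr_lt1// ltW.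
have K0 : 0 < 2 * mu + L ^+ 3 by rewrite addr_gt0 ?mulr_gt0 ?exprn_gt0.
(* [q] is a lower bound, valid for every admissible step size, for the length
   of a step that misses [xstar]. *)
pose q := alpha * L ^+ 2 / (2 * mu + L ^+ 3).
have q0 : 0 < q by rewrite divr_gt0// mulr_gt0// exprn_gt0.
have c0 : 0 < (1 - sigma ^+ 2) * q ^+ 2 by rewrite mulr_gt0// exprn_gt0.
have [||n|l [l1 lle lP]] := @fixed_drop_vanishing _ d _ c0.
- by move=> n; exact: sqr_ge0.
- move=> n; apply: le_trans (descent n).
  by rewrite lerDl mulr_ge0 ?sqr_ge0// ltW.
- rewrite expf_eq0/= normr_eq0 subr_eq0 => xs.
  have qr : q <= `|x n.+1 - x n.+2|.
    apply: (step_length_uniform mu_gt0 L_gt0 alpha_gt0 (Lg n)).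
    apply: (projected_step_length hdot (g0 n) (obtuse n) (lip n)) xs.
    apply: le_trans (growth _ (Xx n.+1)) _.
    by rewrite -subr_ge0 -linearBl; exact: F_mono.
  apply: le_trans (descent n).
  by rewrite lerD2l ler_pM2l// lerXn2r ?nnegrE// ltW.
exists l; split=> //.
  apply: le_trans lle _; rewrite lerD2r /d /q.
  rewrite le_eqVlt; apply/orP; left; apply/eqP.
  by field; rewrite ?gt_eqF.
case=> [|n]; rewrite addn1// ltnS => /lP /eqP.
by rewrite expf_eq0/= normr_eq0 subr_eq0 => /eqP.
Qed.
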